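(* For all integers $J\ge 0$ and $N\ge 0$, $$MO(-2,3J;3N+2)\equiv 0\pmod 9\qquad\text{and}\qquad MO(-2,3J+2;3N+2)\equiv 0\pmod 9.$$
   Context: For an integer $a$ and a nonnegative integer $t$, define $MO(a,t;n)$ by the formal power series identity $$\sum_{n\ge 0}MO(a,t;n)\,q^n=\sum_{1\le n_1<n_2<\cdots<n_t}\frac{q^{n_1+n_2+\cdots+n_t}}{\prod_{k=1}^t(1+aq^{n_k}+q^{2n_k})},$$ where each factor $1/(1+aq^{m}+q^{2m})$ is expanded as a power series in $q$ with integer coefficients; for $t=0$ the sum consists of the empty tuple only, so the right-hand side equals $1$. *)

(* Defs.v *)
From HB Require Import structures.
From mathcomp Require Import all_boot all_order all_algebra.
From mathcomp Require Import boolp.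

Set Implicit Arguments.
Unset Strict Implicit.
Unset Printing Implicit Defensive.

Import Order.TTheory GRing.Theory Num.Theory.
Local Open Scope ring_scope.

(** * Formal power series R[[q]]

    A series is its sequence of coefficients. The structures below make
    [fps R] a [comUnitRingType] in which [f] is a unit exactly when its
    constant coefficient is one, and then [f^-1] is its inverse series. *)

Record fps (R : Type) := FPS { coefs : nat -> R }.
Coercion coefs : fps >-> Funclass.

HB.instance Definition _ (R : Type) := [isNew for @coefs R].
HB.instance Definition _ (R : choiceType) := [Choice of fps R by <:].

Lemma fpsP (R : Type) (f g : fps R) : f =1 g -> f = g.
Proof. by case: f g => [f] [g] /= /funext ->. Qed.

Section FpsZmod.
Variable R : zmodType.
Implicit Types f g h : fps R.

Definition fps_zero : fps R := FPS (fun=> 0).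
Definition fps_opp f : fps R := FPS (fun n => - f n).
Definition fps_add f g : fps R := FPS (fun n => f n + g n).

Fact fps_addA : associative fps_add.
Proof. by move=> f g h; apply: fpsP => n /=; rewrite addrA. Qed.
Fact fps_addC : commutative fps_add.
Proof. by move=> f g; apply: fpsP => n /=; rewrite addrC. Qed.
Fact fps_add0 : left_id fps_zero fps_add.
Proof. by move=> f; apply: fpsP => n /=; rewrite add0r. Qed.
Fact fps_addN : left_inverse fps_zero fps_opp fps_add.
Proof. by move=> f; apply: fpsP => n /=; rewrite addNr. Qed.

HB.instance Definition _ :=
  GRing.isZmodule.Build (fps R) fps_addA fps_addC fps_add0 fps_addN.

Lemma fps_coef0 n : (0 : fps R) n = 0. Proof. by []. Qed.
Lemma fps_coefD f g n : (f + g) n = f n + g n. Proof. by []. Qed.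
Lemma fps_coefN f n : (- f) n = - f n. Proof. by []. Qed.

Lemma fps_coef_sum (I : Type) (r : seq I) (P : pred I) (F : I -> fps R) n :
  (\sum_(i <- r | P i) F i) n = \sum_(i <- r | P i) F i n.
Proof. exact: (big_morph (fun f : fps R => f n) (fun _ _ => erefl) erefl). Qed.

End FpsZmod.

Section FpsRing.
Variable R : comNzRingType.
Implicit Types f g h : fps R.

Definition fps_one : fps R := FPS (fun n => (n == 0%N)%:R).
Definition fps_mul f g : fps R :=
  FPS (fun n => \sum_(i < n.+1) f i * g (n - i)%N).

Definition fps_trunc N f : {poly R} := \poly_(i < N) f i.

Fact coef_trunc N f i : (i < N)%N -> (fps_trunc N f)`_i = f i.
Proof. by move=> lt_iN; rewrite coef_poly lt_iN. Qed.

Fact fps_mul_trunc N f g n : (n < N)%N ->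
  fps_mul f g n = (fps_trunc N f * fps_trunc N g)`_n.
Proof.
move=> lt_nN; rewrite coefM; apply: eq_bigr => i _.
rewrite !coef_trunc //; first exact: leq_ltn_trans (leq_subr _ _) lt_nN.
by apply: leq_ltn_trans lt_nN; rewrite -ltnS.
Qed.

Fact fps_mulC : commutative fps_mul.
Proof.
by move=> f g; apply: fpsP => n; rewrite !(fps_mul_trunc _ _ (ltnSn n)) mulrC.
Qed.

Fact fps_mulA : associative fps_mul.
Proof.
move=> f g h; apply: fpsP => n; set N := n.+1.
have le_N i : (n - i < N)%N by rewrite ltnS leq_subr.
have lt_N (i : 'I_N) : (i < N)%N by [].
transitivity (fps_trunc N f * (fps_trunc N g * fps_trunc N h))`_n.
  rewrite coefM; apply: eq_bigr => i _.
  by rewrite (fps_mul_trunc _ _ (le_N i)) coef_trunc.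
rewrite mulrA coefM; apply: eq_bigr => i _.
by rewrite (fps_mul_trunc _ _ (lt_N i)) coef_trunc.
Qed.

Fact fps_mul1 : left_id fps_one fps_mul.
Proof.
move=> f; apply: fpsP => n /=.
by rewrite big_ord_recl /= mul1r subn0 big1 ?addr0 // => i _; rewrite mul0r.
Qed.

Fact fps_mulDl : left_distributive fps_mul +%R.
Proof.
move=> f g h; apply: fpsP => n; rewrite fps_coefD /= -big_split /=.
by apply: eq_bigr => i _; rewrite mulrDl.
Qed.

Fact fps_one_neq0 : fps_one != 0.
Proof.
apply/eqP => /(congr1 (fun f : fps R => f 0%N)) /= /eqP.
by rewrite oner_eq0.
Qed.

HB.instance Definition _ := GRing.Zmodule_isComNzRing.Build (fps R)
  fps_mulA fps_mulC fps_mul1 fps_mulDl fps_one_neq0.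

Lemma fps_coef1 n : (1 : fps R) n = (n == 0%N)%:R. Proof. by []. Qed.
Lemma fps_coefM f g n : (f * g) n = \sum_(i < n.+1) f i * g (n - i)%N.
Proof. by []. Qed.

Definition fpsX : fps R := FPS (fun n => (n == 1%N)%:R).

Lemma fps_coefXn k n : (fpsX ^+ k) n = (n == k)%:R.
Proof.
elim: k n => [|k IHk] [|n]; rewrite ?expr0 // exprS fps_coefM.
  by rewrite big_ord1 mul0r.
rewrite !big_ord_recl /= mul0r mul1r add0r subSS subn0 IHk eqSS.
by rewrite big1 ?addr0 // => i _; rewrite mul0r.
Qed.

Lemma fps_coefXnM k f n : (n < k)%N -> (fpsX ^+ k * f) n = 0.
Proof.
move=> lt_nk; rewrite fps_coefM big1 // => i _; rewrite fps_coefXn ltn_eqF ?mul0r //.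
by apply: leq_trans lt_nk; case: i.
Qed.

End FpsRing.

Arguments fpsX {R}.

Section FpsUnit.
Variable R : comUnitRingType.
Implicit Types f g : fps R.

Definition fps_unit : pred (fps R) := fun f => f 0%N \is a GRing.unit.

(* The first [n] coefficients of the inverse series, from the recursion
   f_0 g_k = [k = 0] - \sum_(i < k) f_(k - i) g_i.  *)
Fixpoint fps_inv_seq f n : seq R :=
  if n isn't k.+1 then [::] else
  let s := fps_inv_seq f k in
  rcons s ((f 0%N)^-1 * ((k == 0%N)%:R - \sum_(i < k) f (k - i)%N * s`_i)).

Definition fps_inv f : fps R :=
  if fps_unit f then FPS (fun n => (fps_inv_seq f n.+1)`_n) else f.

Fact size_fps_inv_seq f n : size (fps_inv_seq f n) = n.
Proof. by elim: n => //= n IHn; rewrite size_rcons IHn. Qed.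

Fact nth_fps_inv_seq f n i : (i < n)%N ->
  (fps_inv_seq f n)`_i = (fps_inv_seq f i.+1)`_i.
Proof.
elim: n => // n IHn; rewrite ltnS leq_eqVlt => /predU1P[-> // | lt_in].
by rewrite -IHn //= nth_rcons size_fps_inv_seq lt_in.
Qed.

Fact fps_mulVf : {in fps_unit, left_inverse 1 fps_inv *%R}.
Proof.
move=> f Uf; rewrite mulrC; apply: fpsP => n; rewrite fps_coefM fps_coef1.
rewrite /fps_inv ifT //= -(big_mkord xpredT (fun i =>
  f i * (fps_inv_seq f (n - i).+1)`_(n - i)%N)) big_nat_recl //= subn0.
rewrite nth_rcons size_fps_inv_seq ltnn eqxx mulrA divrr // mul1r.
rewrite big_nat_rev big_mkord /= -addrA -[RHS]addr0; congr (_ + _); apply/eqP.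
rewrite addrC subr_eq0; apply/eqP; apply: eq_bigr => i _.
have lt_in := ltn_ord i.
rewrite add0n -subSn // subSS subKn; last exact: ltnW.
by rewrite -(nth_fps_inv_seq f lt_in).
Qed.

Fact fps_unitP f g : g * f = 1 -> fps_unit f.
Proof.
move/(congr1 (fun h : fps R => h 0%N)); rewrite fps_coefM big_ord1 fps_coef1.
by move=> gf1; apply/unitrPr; exists (g 0%N); rewrite mulrC.
Qed.

Fact fps_inv_out : {in [predC fps_unit], fps_inv =1 id}.
Proof.
move=> f nUf; have {}nUf : ~~ fps_unit f := nUf.
by rewrite /fps_inv (negPf nUf).
Qed.

HB.instance Definition _ := GRing.ComNzRing_hasMulInverse.Build (fps R)
  fps_mulVf fps_unitP fps_inv_out.

Lemma fps_unitE f : (f \is a GRing.unit) = (f 0%N \is a GRing.unit).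
Proof. by []. Qed.

End FpsUnit.

Notation "'q" := (@fpsX int) (at level 0) : ring_scope.

Definition MO_den (a : int) (m : nat) : fps int :=
  1 + a%:~R * 'q ^+ m + 'q ^+ (2 * m).

(* All the factors actually inverted are units, so the [^-1] below are genuine
   inverse series. *)
Lemma MO_den_unit (a : int) (m : nat) :
  (0 < m)%N -> MO_den a m \is a GRing.unit.
Proof.
case: m => // m _; rewrite fps_unitE !fps_coefD fps_coef1 mulrC fps_coefXnM //.
by rewrite fps_coefXn mulnS.
Qed.

(* The part 1 <= n_1 < ... < n_t <= B of the sum; the condition [path ltn 0]
   reads 0 < n_1 < ... < n_t. *)
Definition MO_partial (a : int) (t B : nat) : fps int :=
  \sum_(n : t.-tuple 'I_B.+1 | path ltn 0%N [seq val k | k <- n])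
     'q ^+ (\sum_(k <- n) k)%N / \prod_(k <- n) MO_den a k.

(* A tuple with an entry exceeding [n] contributes nothing to the coefficient
   of 'q ^+ n, so the coefficient of 'q ^+ n in the infinite sum is that of any
   partial sum with bound at least [n] (lemma [MO_partial_stable]). *)
Definition MO (a : int) (t n : nat) : int := MO_partial a t n n.

Lemma MO_partial_stable (a : int) (t B n : nat) :
  (n <= B)%N -> MO_partial a t B n = MO a t n.
Proof.
move=> le_nB; have le_nB1 : (n.+1 <= B.+1)%N by [].
rewrite /MO /MO_partial !fps_coef_sum.
rewrite (bigID (fun s : t.-tuple 'I_B.+1 => all (fun k : 'I_B.+1 => k <= n)%N s)) /=.
rewrite [X in _ + X]big1 ?addr0; last first.
  move=> s /andP[_ /allPn[k ks]]; rewrite -ltnNge => lt_nk.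
  apply: fps_coefXnM; apply: leq_trans lt_nk _.
  by rewrite (big_rem k) //= leq_addr.
pose h (s : t.-tuple 'I_n.+1) := [tuple of map (widen_ord le_nB1) s].
pose h' (s : t.-tuple 'I_B.+1) : t.-tuple 'I_n.+1 := [tuple of [seq inord (val k) | k <- s]].
rewrite (reindex_onto h h') /=; last first.
  move=> s /andP[_ /allP les]; apply: val_inj; rewrite /= -map_comp.
  rewrite -[RHS]map_id; apply/eq_in_map => k /les le_kn.
  by apply: val_inj; rewrite /= inordK.
apply: eq_big => [s | s _] /=; last by rewrite !big_map.
have -> : h' (h s) == s.
  apply/eqP/val_inj; rewrite /= -map_comp -[RHS]map_id; apply: eq_map => k.
  by apply: val_inj; rewrite /= inordK //.
rewrite all_map; have -> : all (preim (widen_ord le_nB1) (fun k : 'I_B.+1 => k <= n)%N) s.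
  by apply/allP => k _ /=; rewrite -ltnS.
by rewrite !andbT -map_comp.
Qed.

(* Main.v *)
Require Import Defs.
From mathcomp Require Import all_boot all_order all_algebra.
From mathcomp Require Import ring zify.

Local Open Scope ring_scope.
Import GRing.Theory.

(** Put [1 + z q^m/(1 - q^m)^2 = (1 - x q^m)(1 - q^m/x)/(1 - q^m)^2] with
    [z = 2 - x - 1/x].  A finite form of the Jacobi triple product then gives
    [(q;q)^3 A_t = \sum_n (-1)^n q^(n(n+1)/2) c(n,t)], where [A_t] generates
    [MO(-2,t;n)] and [c(n,t)] is the coefficient of [z^t] in
    [x^-n + ... + x^n].  The exponent [n(n+1)/2] is never 2 mod 3, and is 1
    mod 3 only if [n] is 1 mod 3, in which case [c(n,t)] is divisible by 3
    unless [t] is 1 mod 3.  So for such [t], and in particular for [t = 0]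
    where [A_0 = 1], the coefficient of [q^i] in [(q;q)^3 A_t] is divisible by
    [3^(i mod 3)].  This condition on series is stable under multiplication
    and, for constant term 1, under division, so it passes to [A_t]. *)

(** * The polynomials [chi n] and their coefficients modulo 3 *)

Definition chi_pair (R : comNzRingType) (n : nat) : {poly R} * {poly R} :=
  iter n (fun p => (p.2, (2%:P - 'X) * p.2 - p.1)) (1, 3%:P - 'X).

(* [chi n] is [x^-n + ... + x^n] written as a polynomial in [2 - x - 1/x]. *)
Definition chi (R : comNzRingType) (n : nat) : {poly R} := (chi_pair R n).1.

Lemma chi0 (R : comNzRingType) : chi R 0 = 1.
Proof. by []. Qed.

Lemma chi1 (R : comNzRingType) : chi R 1 = 3%:P - 'X.
Proof. by []. Qed.

Lemma chiSS (R : comNzRingType) n :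
  chi R n.+2 = (2%:P - 'X) * chi R n.+1 - chi R n.
Proof. by []. Qed.

(* [chi (n + 6) + chi n = (x^3 + x^-3) chi (n + 3)]; modulo 3 the factor is a
   polynomial in ['X^3]. *)
Lemma chi_step3 (R : comNzRingType) n :
  chi R n.+3.+3 = (2%:P - 'X^3 + 3%:P * ('X * (2%:P * 'X - 3%:P))) * chi R n.+3 - chi R n.
Proof.
rewrite !chiSS.
have -> : 2%:P = 2 :> {poly R} by rewrite polyC_natr.
have -> : 3%:P = 3 :> {poly R} by rewrite polyC_natr.
ring.
Qed.

(** Modulo 3, such a polynomial is ['X] times a polynomial in ['X^3], a class stable under
    multiplication by polynomials in ['X^3]. *)
Definition class1_mod3 (p : {poly int}) : Prop :=
  forall k, (k %% 3 != 1)%N -> (3 %| p`_k)%Z.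

Lemma class1_mod3_step p r : class1_mod3 p -> class1_mod3 r ->
  class1_mod3 ((2%:P - 'X^3 + 3%:P * ('X * (2%:P * 'X - 3%:P))) * p - r).
Proof.
move=> hp hr k k1; rewrite coefB rpredB ?hr // mulrDl mulrBl -mulrA.
rewrite coefD coefB !coefCM coefXnM rpredD ?dvdz_mulr ?rpredB //.
  by rewrite dvdz_mull ?hp.
by case: ltnP => // lek; apply: hp; lia.
Qed.

Lemma chi_class1 m : class1_mod3 (chi int (3 * m).+1).
Proof.
have h1 : class1_mod3 (chi int 1).
  by case=> [|[|k]] //; rewrite chi1 coefB coefC coefX.
have h4 : class1_mod3 (chi int 4).
  (* The recursion [chi_step3] continued to [chi (-2) = - chi 1]. *)
  have -> : chi int 4 =
    (2%:P - 'X^3 + 3%:P * ('X * (2%:P * 'X - 3%:P))) * chi int 1 - (- chi int 1).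
    rewrite !chiSS chi1 chi0.
    have -> : 2%:P = 2 :> {poly int} by rewrite polyC_natr.
    have -> : 3%:P = 3 :> {poly int} by rewrite polyC_natr.
    ring.
  by apply: class1_mod3_step => // k k1; rewrite coefN rpredN h1.
elim/ltn_ind: m => -[|[|m]] IH //.
have -> : ((3 * m.+2).+1 = (3 * m).+1.+3.+3)%N by lia.
rewrite chi_step3; apply: class1_mod3_step; last exact: IH.
have -> : (3 * m).+4 = (3 * m.+1).+1 by lia.
exact: IH.
Qed.

(** Summation by parts with [(2 - 'X) chi n = chi (n+1) + chi (n-1)]. The exceptional term [- f 0]
    comes from [chi (-1) = - chi 0]. *)
Lemma sum_chi (R : comNzRingType) (f : nat -> {poly R}) M :
  (2%:P - 'X) * (\sum_(n < M.+1) f n * chi R n) =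
  (f 1%N - f 0%N) * chi R 0
    + \sum_(n < M) (f n + f n.+2) * chi R n.+1
    + f M * chi R M.+1 - f M.+1 * chi R M.
Proof.
have [e2 e3] : 2%:P = 2 :> {poly R} /\ 3%:P = 3 :> {poly R} by rewrite !polyC_natr.
elim: M => [|M IH].
  by rewrite big_ord1 big_ord0 chi1 chi0 e2 e3; ring.
rewrite big_ord_recr mulrDr {}IH [in RHS]big_ord_recr /= chiSS e2; ring.
Qed.

(** * The products [(q;q)_n] and the finite Jacobi triple product *)

Definition qpoch (R : comUnitRingType) n : fps R := \prod_(i < n) (1 - fpsX ^+ i.+1).

Lemma qpochS (R : comUnitRingType) n :
  qpoch R n.+1 = qpoch R n * (1 - fpsX ^+ n.+1).
Proof. by rewrite /qpoch big_ord_recr. Qed.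

Lemma qpoch_unit (R : comUnitRingType) n : qpoch R n \is a GRing.unit.
Proof.
apply: rpred_prod => i _; rewrite fps_unitE fps_coefD fps_coefN fps_coefXn.
by rewrite fps_coef1 subr0 unitr1.
Qed.

Lemma qpochV (R : comUnitRingType) n :
  (qpoch R n)^-1 = (1 - fpsX ^+ n.+1) * (qpoch R n.+1)^-1.
Proof.
apply: (mulrI (qpoch_unit R n)); rewrite divrr ?qpoch_unit //.
by rewrite mulrA -qpochS divrr ?qpoch_unit.
Qed.

Lemma qpochD (R : comUnitRingType) a b :
  exists h, qpoch R (a + b) = qpoch R a * (1 + fpsX ^+ a.+1 * h).
Proof.
elim: b => [|b [h IH]]; first by exists 0; rewrite addn0 mulr0 addr0 mulr1.
exists (h - fpsX ^+ b * (1 + fpsX ^+ a.+1 * h)).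
rewrite addnS qpochS IH -addSn exprD; ring.
Qed.

(* The convention [1/(q;q)_k = 0] for [k < 0]. *)
Definition inv_qpoch_sub (R : comUnitRingType) B n : fps R :=
  if (n <= B)%N then (qpoch R (B - n))^-1 else 0.

Lemma inv_qpoch_subS (R : comUnitRingType) B n :
  inv_qpoch_sub R B n.+1 = (1 - fpsX ^+ (B - n)) * inv_qpoch_sub R B n.
Proof.
rewrite /inv_qpoch_sub; have [lt_nB | le_Bn] := ltnP n B.
  by rewrite (ltnW lt_nB) -(subnSK lt_nB) -qpochV.
by move: (le_Bn); rewrite -subn_eq0 => /eqP->; rewrite expr0 subrr mul0r.
Qed.

Definition triangular n := 'C(n.+1, 2).

Lemma triangularS n : (triangular n.+1 = triangular n + n.+1)%N.
Proof. by rewrite /triangular binS bin1. Qed.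

(* [q^(n(n+1)/2)] times the Gaussian binomial [2B+1; B-n]. *)
Definition jtp_coef (R : comUnitRingType) B n : fps R :=
  fpsX ^+ triangular n * qpoch R (2 * B).+1 * inv_qpoch_sub R B n * (qpoch R (B + n).+1)^-1.

(** The case [n = -1] of [jtp_coef_rec]: the symmetry [n -> -1-n] of the Gaussian binomials and of
    [n(n+1)/2] replaces the term of index -1 by that of index 0. *)
Lemma jtp_coef_rec0 (R : comUnitRingType) B :
  jtp_coef R B.+1 0 = (1 + fpsX ^+ B.+1 ^+ 2) * jtp_coef R B 0
    + fpsX ^+ B.+1 * (jtp_coef R B 0 + jtp_coef R B 1).
Proof.
rewrite /jtp_coef !inv_qpoch_subS !addn0 addn1.
rewrite /inv_qpoch_sub !leq0n !subn0.
rewrite (qpochV R B) (qpochV R B.+1).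
rewrite [(2 * B.+1)%N]mulnS !addSn !add0n (qpochS R (2 * B).+2) (qpochS R (2 * B).+1).
set w := (qpoch R B.+2)^-1; set u := qpoch R (2 * B).+1.
rewrite (_ : triangular 0 = 0%N) // (_ : triangular 1 = 1%N) // mul2n -addnn.
rewrite !exprS !exprD !expr0; ring.
Qed.

Lemma jtp_coef_rec (R : comUnitRingType) B n :
  jtp_coef R B.+1 n.+1 = (1 + fpsX ^+ B.+1 ^+ 2) * jtp_coef R B n.+1
    + fpsX ^+ B.+1 * (jtp_coef R B n + jtp_coef R B n.+2).
Proof.
rewrite /jtp_coef.
have -> : inv_qpoch_sub R B.+1 n.+1 = inv_qpoch_sub R B n by [].
rewrite !inv_qpoch_subS.
have [lt_Bn | le_nB] := ltnP B n.
  by rewrite /inv_qpoch_sub leqNgt lt_Bn /=; ring.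
have [j ->] : exists j, B = (n + j)%N by exists (B - n)%N; rewrite subnKC.
set h := inv_qpoch_sub R (n + j) n.
rewrite !triangularS subnS addKn !addSn !addnS mulnS !addSn add0n.
set m := (n + j + n)%N.
rewrite (qpochV R m.+1) (qpochV R m.+2) (qpochS R (2 * (n + j)).+2) (qpochS R (2 * (n + j)).+1).
set w := (qpoch R m.+3)^-1; set u := qpoch R (2 * (n + j)).+1.
(* For [j = 0] the exponent [j.-1] is truncated to 0, which is harmless because its term also
   carries the factor [1 - fpsX ^+ 0 = 0]. *)
rewrite /m mul2n -addnn; case: j @m @w @h @u => [|j] m w h u.
  rewrite addn0 expr0 !exprS !exprD; ring.
rewrite /= !addnS !exprS !exprD; ring.
Qed.

Lemma jtp_coef_out (R : comUnitRingType) B n : (B < n)%N -> jtp_coef R B n = 0.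
Proof. by move=> ltBn; rewrite /jtp_coef /inv_qpoch_sub leqNgt ltBn /= mulr0 mul0r. Qed.

(** With [Q = q^(B+1)], the new factor in the induction is [(1 + Q^2) - Q (2 - 'X)], so [sum_chi]
    reduces the step to the two recursions for [jtp_coef]. *)
Lemma finite_jtp (R : comUnitRingType) B :
  \prod_(m < B) (((1 - fpsX ^+ m.+1) ^+ 2)%:P + (fpsX ^+ m.+1)%:P * 'X) =
  \sum_(n < B.+1) ((-1) ^+ n * jtp_coef R B n)%:P * chi (fps R) n.
Proof.
elim: B => [|B IH].
  rewrite big_ord0 big_ord1 chi0 /jtp_coef /inv_qpoch_sub /= mul1r.
  have -> : qpoch R (0 - 0) = 1 by rewrite /qpoch big_ord0.
  by rewrite invr1 !mulr1 mul1r divrr ?qpoch_unit.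
rewrite big_ord_recr /= IH.
pose f n : {poly fps R} := ((-1) ^+ n * jtp_coef R B n)%:P.
have f_out n : (B < n)%N -> f n = 0 by move=> ltBn; rewrite /f jtp_coef_out ?mulr0.
have -> : \sum_(n < B.+1) ((-1) ^+ n * jtp_coef R B n)%:P * chi (fps R) n =
          \sum_(n < B.+2) f n * chi (fps R) n.
  by rewrite [RHS]big_ord_recr /= f_out // mul0r addr0.
set Q := fpsX ^+ B.+1; set S := \sum_(n < B.+2) _.
have -> : S * (((1 - Q) ^+ 2)%:P + Q%:P * 'X) =
          (1 + Q ^+ 2)%:P * S - Q%:P * ((2%:P - 'X) * S).
  have -> : 2%:P = 2 :> {poly fps R} by rewrite polyC_natr.
  by rewrite !(rmorphXn, rmorphD, rmorphN, rmorph1) /=; ring.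
rewrite (sum_chi _ f) (f_out B.+1) // (f_out B.+2) // !mul0r addr0 subr0 /S !(big_ord_recl B.+1) /=.
rewrite !mulrDr !mulr_sumr opprD -!sumrN addrACA -big_split /=.
congr (_ + _).
  rewrite chi0 !mulr1 jtp_coef_rec0 -/Q /f expr0 expr1.
  rewrite !(rmorphM, rmorphD, rmorphN, rmorph1, rmorphXn) /=; ring.
apply: eq_bigr => n _; rewrite /bump /= add1n jtp_coef_rec -/Q /f !exprS.
rewrite !(rmorphM, rmorphD, rmorphN, rmorph1, rmorphXn) /=; ring.
Qed.

(** The quotients [(q;q)_B / (q;q)_(B-n)] and [(q;q)_(2B+1) / (q;q)_(B+n+1)] are 1 modulo
    [q^(B-n+1)]. The missing [q^n] is taken from [q^(n(n+1)/2)]. *)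
Lemma qpoch_jtp_coef (R : comUnitRingType) B n : (n <= B)%N ->
  exists h, qpoch R B * jtp_coef R B n = fpsX ^+ triangular n + fpsX ^+ B.+1 * h.
Proof.
move=> le_nB; rewrite /jtp_coef /inv_qpoch_sub le_nB.
have [h1 e1] := qpochD R (B - n) n; have [h2 e2] := qpochD R (B + n).+1 (B - n).
rewrite subnK // in e1; rewrite (_ : (B + n).+1 + _ = (2 * B).+1)%N in e2; last lia.
exists (fpsX ^+ (triangular n - n) * (h1 + fpsX ^+ (2 * n).+1 * h2 * (1 + fpsX ^+ (B - n).+1 * h1))).
have le_nT : (n <= triangular n)%N by elim: (n) => // m IH; rewrite triangularS; lia.
have U1 := qpoch_unit R (B - n); have U2 := qpoch_unit R (B + n).+1.
rewrite e2 {1}e1; set a := qpoch R (B - n) in U1 *; set b := qpoch R _ in U2 *.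
have -> : a * (1 + fpsX ^+ (B - n).+1 * h1) * (fpsX ^+ triangular n *
    (b * (1 + fpsX ^+ (B + n).+2 * h2)) / a / b) =
   (a / a) * (b / b) * fpsX ^+ triangular n * (1 + fpsX ^+ (B - n).+1 * h1) * (1 + fpsX ^+ (B + n).+2 * h2).
  by ring.
rewrite !divrr //.
have -> : ((B + n).+2 = (B - n).+1 + (2 * n).+1)%N by lia.
have -> : triangular n = ((triangular n - n) + n)%N by lia.
rewrite addnK; have -> : (B.+1 = (B - n).+1 + n)%N by lia.
by rewrite !exprD; ring.
Qed.

(** * Partial sums as elementary symmetric functions *)

Lemma coef_prod_linear (R : comNzRingType) (I : finType) (w : I -> R) k :
  (\prod_i ((w i)%:P * 'X + 1))`_k = \sum_(A : {set I} | #|A| == k) \prod_(i in A) w i.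
Proof.
rewrite bigA_distr coef_sum [RHS]big_mkcond /=; apply: eq_bigr => A _.
rewrite -big_mkcond big_split /= prodr_const -rmorph_prod coefCM coefXn eq_sym.
by case: eqP; rewrite ?mulr1 ?mulr0.
Qed.

Lemma sum_ltn_sorted_tuples (V : nmodType) n t (F : {set 'I_n.+1} -> V) :
  \sum_(s : t.-tuple 'I_n.+1 | sorted ltn (map val s)) F [set i in s] =
  \sum_(A : {set 'I_n.+1} | #|A| == t) F A.
Proof.
(* Cutting or padding to length [t] makes [tup] total; it is the increasing enumeration of [A] once
   [#|A| = t]. *)
pose tup (A : {set 'I_n.+1}) : t.-tuple _ := [tuple of mkseq (nth ord0 (enum A)) t].
have val_tup (A : {set 'I_n.+1}) : #|A| = t -> val (tup A) = enum A.
  by move=> At; rewrite -[enum _](mkseq_nth ord0) -cardE At.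
have sorted_enum (A : {set 'I_n.+1}) : sorted ltn (map val (enum A)).
  rewrite -[enum _](eq_filter (mem_enum _)) -(eq_filter (mem_map val_inj _)) -filter_map.
  by rewrite (sorted_filter ltn_trans) // unlock val_ord_enum iota_ltn_sorted.
rewrite [RHS](reindex_onto (fun s : t.-tuple _ => [set i in s]) tup) /=; last first.
  by move=> A /eqP At; apply/setP => x; rewrite inE -(mem_enum A) -val_tup.
apply: eq_bigl => s; apply/idP/andP => [inc_s | [/eqP st /eqP <-]]; last by rewrite val_tup.
have st : #|[set i in s]| = t.
  rewrite cardsE (card_uniqP _) ?size_tuple // -(map_inj_uniq val_inj).
  exact: (sorted_uniq ltn_trans ltnn).
split; first exact/eqP.
rewrite -val_eqE val_tup // -(inj_eq (inj_map val_inj)) /=.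
apply/eqP/(irr_sorted_eq ltn_trans ltnn) => // y.
by apply/mapP/mapP=> [] [x s_x ->]; exists x; rewrite // mem_enum inE in s_x *.
Qed.

(** The value 0 at [m = 0] encodes [0 < n_1]: subsets containing 0 contribute nothing. *)
Definition MO_weight a (m : nat) : fps int :=
  if m is 0 then 0 else 'q ^+ m / MO_den a m.

Lemma MO_partialE a t B :
  MO_partial a t B =
  \sum_(A : {set 'I_B.+1} | #|A| == t) \prod_(i in A) MO_weight a i.
Proof.
rewrite -sum_ltn_sorted_tuples /MO_partial.
rewrite [RHS](bigID (fun s : t.-tuple 'I_B.+1 => all (ltn 0) [seq val k | k <- s])) /=.
rewrite [X in _ + X]big1 ?addr0.
  apply: eq_big => [s | s]; first by rewrite (path_sortedE ltn_trans) andbC.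
  rewrite (path_sortedE ltn_trans) => /andP[s_gt0 s_sorted].
  have s_uniq : uniq s.
    by rewrite -(map_inj_uniq val_inj); exact: (sorted_uniq ltn_trans ltnn).
  transitivity (\prod_(k <- s) MO_weight a k).
    have {}s_gt0 : all (fun k : 'I_B.+1 => 0 < k)%N s by rewrite all_map in s_gt0.
    elim: (val s) s_gt0 => [|k r IH] /=; first by rewrite !big_nil expr0 invr1 mulr1.
    case/andP=> k_gt0 r_gt0; rewrite !big_cons -IH // exprD.
    rewrite invrM ?MO_den_unit //.
      by rewrite /MO_weight; case: (val k) k_gt0 => // m _; ring.
    elim: r r_gt0 {IH} => [|j r IH] /=; first by rewrite big_nil unitr1.
    by case/andP=> j_gt0 r_gt0; rewrite big_cons unitrM MO_den_unit ?IH.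
  rewrite big_uniq //=; apply: eq_bigl => i; by rewrite inE.
move=> s /andP[s_sorted]; rewrite all_map => /allPn[k ks]; rewrite /= -eqn0Ngt => k0.
by rewrite (bigD1 k) ?inE //= (eqP k0) mul0r.
Qed.

Lemma MO_partial0 a B : MO_partial a 0 B = 1.
Proof.
rewrite MO_partialE (big_pred1 set0) ?big_set0 // => A; exact: cards_eq0.
Qed.

Lemma coef_prod_MO a t B :
  (\prod_(m < B) ((MO_den a m.+1)%:P + ('q ^+ m.+1)%:P * 'X))`_t =
  (\prod_(m < B) MO_den a m.+1) * MO_partial a t B.
Proof.
have factor (m : 'I_B) : (MO_den a m.+1)%:P + ('q ^+ m.+1)%:P * 'X =
    (MO_den a m.+1)%:P * ((MO_weight a m.+1)%:P * 'X + 1) :> {poly fps int}.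
  rewrite mulrDr mulr1 addrC mulrA -rmorphM /= mulrC.
  by rewrite /MO_weight [_ * (_ / _)]mulrC divrK ?MO_den_unit // mulrC.
rewrite (eq_bigr _ (fun m _ => factor m)) big_split /= -rmorph_prod coefCM.
by rewrite MO_partialE -coef_prod_linear big_ord_recl /= mul0r add0r mul1r.
Qed.

(** * Coefficients of [(q;q)_B^3] times a partial sum *)

Lemma triangular_mod3 m : (triangular m %% 3 = (m %% 3 == 1))%N.
Proof.
elim/ltn_ind: m => -[|[|[|m]]] IH //.
have := IH m; rewrite !triangularS; lia.
Qed.

Lemma map_chi (R : comNzRingType) n : map_poly intr (chi int n) = chi R n.
Proof.
elim/ltn_ind: n => -[|[|n]] IH.
- by rewrite !chi0 rmorph1.
- by rewrite !chi1 rmorphB /= map_polyC map_polyX.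
- by rewrite !chiSS rmorphB rmorphM rmorphB /= !IH // map_polyC map_polyX.
Qed.

Lemma fps_coefMz (f : fps int) c n : (f * c%:~R) n = f n * c.
Proof.
have coefMn (m : nat) : (f *+ m) n = f n *+ m.
  by elim: m => // m IH; rewrite !mulrSr fps_coefD IH.
rewrite mulrzr -[in RHS](intz c) mulrzr.
by case: c => m; rewrite /intmul /= ?fps_coefN coefMn.
Qed.

(** For [a = -2] the denominators multiply to [(q;q)_B^2]. The third factor [(q;q)_B] is the one
    [qpoch_jtp_coef] needs to clear the Gaussian binomials up to degree [B]. *)
Lemma qpoch3_MO_partial t B :
  qpoch int B ^+ 3 * MO_partial (-2) t B =
  \sum_(n < B.+1)
     qpoch int B * jtp_coef int B n * ((-1) ^+ n * (chi int n)`_t)%:~R.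
Proof.
have -> : qpoch int B ^+ 3 * MO_partial (-2) t B =
    qpoch int B * (\prod_(m < B) ((MO_den (-2) m.+1)%:P + ('q ^+ m.+1)%:P * 'X))`_t.
  rewrite coef_prod_MO mulrA; congr (_ * _).
  have -> : \prod_(m < B) MO_den (-2) m.+1 = qpoch int B ^+ 2.
    rewrite -prodrXl; apply: eq_bigr => m _.
    by rewrite /MO_den mulnC exprM rmorphN /=; ring.
  by rewrite -exprS.
have -> : \prod_(m < B) ((MO_den (-2) m.+1)%:P + ('q ^+ m.+1)%:P * 'X) =
    \prod_(m < B) (((1 - 'q ^+ m.+1) ^+ 2)%:P + ('q ^+ m.+1)%:P * 'X).
  apply: eq_bigr => m _; congr (_%:P + _).
  by rewrite /MO_den mulnC exprM rmorphN /=; ring.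
rewrite finite_jtp coef_sum mulr_sumr; apply: eq_bigr => n _.
rewrite coefCM -map_chi coef_map /= rmorphM rmorphXn rmorphN1 /=; ring.
Qed.

Lemma coef_qpoch3_MO_partial t B i : (i <= B)%N ->
  (qpoch int B ^+ 3 * MO_partial (-2) t B) i =
  \sum_(n < B.+1 | i == triangular n) (-1) ^+ n * (chi int n)`_t.
Proof.
move=> le_iB; rewrite qpoch3_MO_partial fps_coef_sum [RHS]big_mkcond.
apply: eq_bigr => n _; have [h qd] := @qpoch_jtp_coef int B n (ltn_ord n).
have {qd}-> : qpoch int B * jtp_coef int B n = 'q ^+ triangular n + 'q ^+ B.+1 * h := qd.
rewrite fps_coefMz fps_coefD fps_coefXn fps_coefXnM ?ltnS // addr0.
by case: eqP; rewrite ?mul1r ?mul0r.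
Qed.

(** * Divisibility of coefficients by powers of 3 *)

Definition graded3 B (f : fps int) : Prop :=
  forall n, (n <= B)%N -> (3 ^+ (n %% 3) %| f n)%Z.

(** By induction on [n], solving the convolution for [g n]; the other terms are divisible because
    [(i + j) mod 3 <= (i mod 3) + (j mod 3)]. *)
Lemma graded3_div B (f g : fps int) :
  f 0%N = 1 -> graded3 B f -> graded3 B (f * g) -> graded3 B g.
Proof.
move=> f0 gf gfg n; elim/ltn_ind: n => n IH le_nB.
have := gfg n le_nB; rewrite fps_coefM big_ord_recl f0 mul1r subn0.
rewrite rpredDr //; apply: rpred_sum => i _; rewrite /= /bump add1n.
have lt_in := ltn_ord i.
apply: (@dvdz_trans (3 ^+ (i.+1 %% 3) * 3 ^+ ((n - i.+1) %% 3))).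
  by rewrite -exprD dvdz_exp2l //; lia.
by apply: dvdz_mul; [apply: gf | apply: IH]; lia.
Qed.

Lemma graded3_qpoch3_MO_partial t B : (t %% 3 != 1)%N ->
  graded3 B (qpoch int B ^+ 3 * MO_partial (-2) t B).
Proof.
move=> t1 i le_iB; rewrite coef_qpoch3_MO_partial //.
apply: rpred_sum => n /eqP ->; rewrite triangular_mod3.
have [n1 | _] := eqP; last by rewrite expr0 dvd1z.
have [m ->] : exists m, val n = (3 * m).+1 by exists (n %/ 3)%N => /=; lia.
by rewrite expr1 dvdz_mull // chi_class1.
Qed.

Lemma graded3_MO_partial t B : (t %% 3 != 1)%N -> graded3 B (MO_partial (-2) t B).
Proof.
move=> t1; apply: (@graded3_div B (qpoch int B ^+ 3)).
(* Since the partial sum for [t = 0] is 1, the formula at [t = 0] describes [(q;q)_B^3] itself. *)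
- rewrite -[_ ^+ 3]mulr1 -(MO_partial0 (-2) B) coef_qpoch3_MO_partial //.
  rewrite big_mkcond big_ord_recl chi0 coef1 /= big1 ?addr0 // => j _.
  by rewrite triangularS addnS.
- by rewrite -[_ ^+ 3]mulr1 -(MO_partial0 (-2) B); exact: graded3_qpoch3_MO_partial.
- exact: graded3_qpoch3_MO_partial.
Qed.

Theorem theorem6p7 (J N : nat) :
  (MO (-2) (3 * J) (3 * N + 2) = 0 %[mod 9])%Z /\
  (MO (-2) (3 * J + 2) (3 * N + 2) = 0 %[mod 9])%Z.
Proof.
have MO_dvd9 t : (t %% 3 != 1)%N -> (MO (-2) t (3 * N + 2) = 0 %[mod 9])%Z.
  move=> t1; rewrite mod0z; apply/dvdz_mod0P.
  have := @graded3_MO_partial t _ t1 _ (leqnn (3 * N + 2)).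
  by rewrite mulnC modnMDl.
by split; apply: MO_dvd9; lia.
Qed.
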